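(* For every $N\ge 4$ of the form $N=4M$, $N=4M+2$, $N=4M+3$, or $N=4M+5$ with $M\ge 1$, there exist at least $s_N$ equivalence classes of partitions of $N$ such that every summand satisfies $N_j\ge 2$ and such that for every such partition $\pi(N)$ the Weyl group is nontrivial, where respectively $s_N=P(\frac N4)$, $s_N=P(\frac{N-2}{4})$, $s_N=P(\frac{N-3}{4})$, $s_N=P(\frac{N-5}{4})$.
   Context: A partition of $N$ of length $r$ is a sequence $\pi=(N_1,\dots,N_r)$ of positive integers with $N_1+\dots+N_r=N$. Two partitions $(N_1,\dots,N_r)$, $(M_1,\dots,M_s)$ of $N$ are equivalent if $r=s$ and $N_j=M_{\sigma(j)}$ for some permutation $\sigma$ of $\{1,\dots,r\}$. $P(n)$ is the number of unordered partitions of $n$ into positive integers. The Weyl group of a partition $\pi=(N_1,\dots,N_r)$ is the Weyl group $\mathcal{N}(H)/H$ of $H=O(N_1)\times\dots\times O(N_r)$ in $O(N)$ ($\mathcal{N}(H)$ the normalizer in $O(N)$); it is isomorphic to the group $\mathfrak{S}_\pi$ of permutations $\sigma\in\mathfrak{S}(r)$ with $N_{\sigma(j)}=N_j$ for all $j$. *)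

(* Defs.v *)
From mathcomp Require Import all_boot all_order all_fingroup all_algebra.
From mathcomp Require Import classical_sets cardinality reals.

Import Order.TTheory GRing.Theory Num.Theory.
Local Open Scope classical_set_scope.
Local Open Scope ring_scope.

Definition summand {p : seq nat} (j : 'I_(size p)) : nat := nth 0%N p j.

Definition is_partition (N : nat) (pi : seq nat) : Prop :=
  (forall j : 'I_(size pi), (0 < summand j)%N) /\
  (\sum_(j < size pi) summand j)%N = N.

Definition equiv_partitions (pi rho : seq nat) : Prop :=
  exists (e : size pi = size rho) (sigma : 'S_(size rho)),
    forall j : 'I_(size pi), summand j = summand (sigma (cast_ord e j)).

Definition partition_class (N : nat) (pi : seq nat) : set (seq nat) :=
  [set rho | is_partition N rho /\ equiv_partitions pi rho].

Definition partition_classes (N : nat) : set (set (seq nat)) :=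
  [set partition_class N pi | pi in is_partition N].

(* An unordered partition of n is a multiset of positive integers, encoded by
   its multiplicities: m i is the number of summands equal to i + 1. *)
Definition npartitions (n : nat) : nat :=
  #|[pred m : {ffun 'I_n -> 'I_n.+1} | (\sum_(i < n) m i * i.+1)%N == n]|.

Section Weyl.
Variable R : realType.

Definition orthogonal_group (n : nat) : set 'M[R]_n :=
  [set A | A *m A^T = 1%:M].

(* The ambient group is O(N) for N the sum of the summands of pi. *)
Definition block_subgroup (pi : seq nat) :
    set 'M[R]_(\sum_(j < size pi) summand j) :=
  [set \mxdiag_(j < size pi) B j
    | B in [set B : forall j : 'I_(size pi), 'M[R]_(summand j)
           | forall j, orthogonal_group (summand j) (B j)]].

Definition normalizer {n : nat} (H : set 'M[R]_n) : set 'M[R]_n :=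
  [set g | orthogonal_group n g /\ [set g *m h *m invmx g | h in H] = H].

Definition left_coset {n : nat} (g : 'M[R]_n) (H : set 'M[R]_n) :
    set 'M[R]_n :=
  [set g *m h | h in H].

(* The underlying set of the quotient group N(H)/H; its identity is H. *)
Definition weyl_group (pi : seq nat) :
    set (set 'M[R]_(\sum_(j < size pi) summand j)) :=
  [set left_coset g (block_subgroup pi)
    | g in normalizer (block_subgroup pi)].

Definition weyl_nontrivial (pi : seq nat) : Prop :=
  exists2 C, weyl_group pi C & C <> block_subgroup pi.

Definition admissible_classes (N : nat) : set (set (seq nat)) :=
  [set C | partition_classes N C /\
     forall pi, C pi ->
       (forall j : 'I_(size pi), (2 <= summand j)%N) /\ weyl_nontrivial pi].

End Weyl.

(* Main.v *)
(** Doubling every part and repeating it sends a partition [a_1 + ... + a_k] of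
    [M] to [2a_1 + 2a_1 + ... + 2a_k + 2a_k], a partition of [4M]; a summand
    [2], [3] or [5] accounts for the other residues.  All summands are at least
    [2], the multiplicities of the original partition can be read off the
    multiset obtained, and each summand [2a_i] is repeated.  The permutation
    matrix exchanging two equal blocks normalizes the block subgroup without
    belonging to it, so the Weyl group is nontrivial. *)

Require Import Defs.
From mathcomp Require Import all_boot all_order all_fingroup all_algebra.
From mathcomp Require Import classical_sets cardinality reals.
From mathcomp Require Import functions zify.

Import GRing.Theory.

Local Open Scope classical_set_scope.
Local Open Scope card_scope.

Section BlockSwap.
Local Open Scope ring_scope.
Variable R : realType.

Lemma orthogonal_group1 n : orthogonal_group R n 1%:M.
Proof. by rewrite /orthogonal_group/= trmx1 mulmx1. Qed.

(** The two [pid_mx] only transport [A] along [m = n]: once the equality is destructed, both are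
    identity matrices. *)
Lemma pid_mx_orthogonal_conj (m n : nat) (A : 'M[R]_n) : m = n ->
  orthogonal_group R n A ->
  orthogonal_group R m
    ((pid_mx m : 'M_(m, n)) *m A *m (pid_mx n : 'M_(n, m))).
Proof. by move=> e; case: _ / e A => A; rewrite pid_mx_1 mul1mx mulmx1. Qed.

Section Involution.
Variables (n : nat) (p : 'I_n -> nat) (s : 'I_n -> 'I_n).
Hypothesis sK : involutive s.
Hypothesis ps : forall i, p (s i) = p i.

(* [p (s i)] and [p i] are equal only propositionally: a rectangular
   [pid_mx] plays the role of the identity block without any cast. *)
Definition block_perm : 'M[R]_(\sum_i p i) :=
  \mxblock_(i < n, j < n)
    (if j == s i then (pid_mx (p i) : 'M_(p i, p j)) else 0).

Lemma block_perm_conj (B : forall i, 'M[R]_(p i)) :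
  block_perm *m (\mxdiag_i B i) *m block_perm =
  \mxdiag_i ((pid_mx (p i) : 'M_(p i, p (s i))) *m B (s i)
               *m (pid_mx (p (s i)) : 'M_(p (s i), p i))).
Proof.
rewrite mul_mxblock_mxdiag mul_mxblock; apply/eq_mxblockP => i k.
(* Row [i] of [block_perm] has its only possibly nonzero block in column [s i], so one term of the
   sum survives. *)
rewrite (bigD1 (s i)) //= eqxx big1 ?addr0; last first.
  by move=> j /negPf ->; rewrite !mul0mx.
rewrite sK eq_sym; case: eqVneq => [<-|_]; last by rewrite mulmx0.
by rewrite conform_mx_id.
Qed.

Lemma block_permK : block_perm *m block_perm = 1%:M.
Proof.
(* The square is the conjugate of the identity, seen as a block diagonal matrix. *)
have := block_perm_conj (fun i => 1%:M); rewrite mxdiagZ mulmx1 => ->.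
rewrite -mxdiagZ; apply: eq_mxdiag => i.
by rewrite mulmx1 mul_pid_mx ps !minnn pid_mx_1.
Qed.

(** As [s] is an involution, [j == s i] and [i == s j] agree. With [block_permK], symmetry makes the
    matrix orthogonal. *)
Lemma tr_block_perm : block_perm^T = block_perm.
Proof.
rewrite tr_mxblock; apply/eq_mxblockP => i j.
rewrite -(inj_eq (inv_inj sK)) sK eq_sym.
by case: eqVneq => [->|_]; rewrite ?trmx0 ?tr_pid_mx ?ps.
Qed.

(** The off-diagonal block at [(a, s a)] has top left entry 1 in [block_perm] and 0 in a block
    diagonal matrix. *)
Lemma block_perm_not_mxdiag (a : 'I_n) (B : forall i, 'M[R]_(p i)) :
  s a != a -> (0 < p a)%N -> block_perm <> \mxdiag_i B i.
Proof.
move=> sa pa /(congr1 (fun A => submxblock A a (s a))).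
rewrite !mxblockK eqxx eq_sym (negPf sa).
have psa : (0 < p (s a))%N by rewrite ps.
move=> /matrixP/(_ (Ordinal pa) (Ordinal psa)); rewrite !mxE /= pa.
by apply/eqP; rewrite oner_eq0.
Qed.

End Involution.

Lemma weyl_nontrivial_of_repeat (pi : seq nat) (a b : 'I_(size pi)) :
  a != b -> summand a = summand b -> (0 < summand a)%N -> weyl_nontrivial R pi.
Proof.
move=> ab pab pa; pose s := tperm a b.
have sK : involutive s := tpermK a b.
have ps i : summand (s i) = summand i by rewrite /s; case: tpermP => [->|->|].
set p := fun j : 'I_(size pi) => summand j.
pose g := block_perm _ p s.
have gg : g *m g = 1%:M := block_permK _ _ _ sK ps.
have ug : g \in unitmx by case/mulmx1_unit: gg.
have ig : invmx g = g by rewrite -[RHS](mulKmx ug) gg mulmx1.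
have conjH h : block_subgroup R pi h -> block_subgroup R pi (g *m h *m g).
  case=> B /= hB <-; rewrite (block_perm_conj _ _ _ sK).
  eexists; last by [].
  by move=> j; apply: pid_mx_orthogonal_conj => //; rewrite /p ps.
have H1 : block_subgroup R pi 1%:M.
  exists (fun j => 1%:M); last exact: mxdiagZ.
  by move=> j; apply: orthogonal_group1.
exists (left_coset R g (block_subgroup R pi)).
  exists g => //; split.
    by rewrite /orthogonal_group /= /g tr_block_perm.
  apply/seteqP; split => [_ [h hH <-]|h hH]; first by rewrite ig; apply: conjH.
  (* Since [g] is its own inverse, stability under conjugation also gives the reverse inclusion. *)
  exists (g *m h *m g); first exact: conjH.
  by rewrite ig !mulmxA gg mul1mx -mulmxA gg mulmx1.
(* If the coset were the subgroup itself, it would make [g] block diagonal. *)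
move=> gH; have : left_coset R g (block_subgroup R pi) g.
  by exists 1%:M; rewrite ?mulmx1.
rewrite gH => -[B _ /esym].
by apply: (block_perm_not_mxdiag _ _ _ ps a) => //; rewrite /s tpermL eq_sym.
Qed.

End BlockSwap.

Lemma sum_summand (pi : seq nat) : (\sum_(j < size pi) summand j)%N = sumn pi.
Proof. by rewrite sumnE (big_nth 0%N) big_mkord. Qed.

Lemma equiv_partitions_refl (pi : seq nat) : equiv_partitions pi pi.
Proof.
by exists erefl, 1%g => j; rewrite perm1 cast_ord_id.
Qed.

Lemma equiv_partitions_perm_eq (pi rho : seq nat) :
  equiv_partitions pi rho -> perm_eq pi rho.
Proof.
case=> e [sigma h].
apply/(@tuple_permP _ _ pi (in_tuple rho)); exists sigma.
apply: (@eq_from_nth _ 0%N) => [|i hi]; first by rewrite size_tuple.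
have hi' : (i < size rho)%N by rewrite -e.
have := h (Ordinal hi); rewrite /summand /= => ->.
rewrite -[RHS](@tnth_nth _ _ _ [tuple _ | i < size rho] (Ordinal hi')).
rewrite tnth_mktuple (tnth_nth 0%N) /=.
by congr (nth _ _ (sigma _)); apply: val_inj.
Qed.

Lemma weyl_nontrivial_of_not_uniq (R : realType) (pi : seq nat) :
  (forall j : 'I_(size pi), (0 < summand j)%N) -> ~~ uniq pi ->
  weyl_nontrivial R pi.
Proof.
move=> pos /(uniqPn 0%N) [i [j [ij js eij]]].
apply: (@weyl_nontrivial_of_repeat R pi (Ordinal (ltn_trans ij js))
          (Ordinal js)) => //.
by rewrite -val_eqE /= ltn_eqF.
Qed.

Section Doubling.
Variable M : nat.
Implicit Types (m : {ffun 'I_M -> 'I_M.+1}) (c : seq nat).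

Definition doubled_partition m c : seq nat :=
  flatten [seq nseq (2 * m i) (2 * i.+1) | i <- enum 'I_M] ++ c.

Lemma sumn_doubled_partition m c :
  sumn (doubled_partition m c) = (4 * (\sum_(i < M) m i * i.+1) + sumn c)%N.
Proof.
rewrite /doubled_partition sumn_cat; congr addn.
rewrite sumn_flatten -map_comp sumnE big_map big_enum /= big_distrr /=.
by apply: eq_bigr => i _; rewrite sumn_nseq; lia.
Qed.

Lemma count_doubled_partition m c (i : 'I_M) :
  count_mem (2 * i.+1)%N (doubled_partition m c)
    = (2 * m i + count_mem (2 * i.+1)%N c)%N.
Proof.
rewrite count_cat count_flatten -map_comp sumnE big_map big_enum /=.
rewrite (bigD1 i) //= count_nseq /= eqxx mul1n big1 ?addn0 // => j ji.
rewrite count_nseq /= eqn_pmul2l // eqSS.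
by rewrite val_eqE (negPf ji).
Qed.

(** The part [2 * i.+1] occurs [2 * m i] times plus its count in [c]; the latter is common to both
    sides and cancels. *)
Lemma doubled_partition_inj m m' c :
  perm_eq (doubled_partition m c) (doubled_partition m' c) -> m = m'.
Proof.
move=> /seq.permP e; apply/ffunP => i; apply: val_inj.
have := e (pred1 (2 * i.+1)%N); rewrite !count_doubled_partition /=; lia.
Qed.

Lemma all_doubled_partition m c :
  all (leq 2) c -> all (leq 2) (doubled_partition m c).
Proof.
move=> hc; rewrite all_cat hc andbT; apply/allP => x /flattenP [_ /mapP [i _ ->]].
by rewrite mem_nseq => /andP[_ /eqP ->]; lia.
Qed.

(** Without repetition every count is at most 1, which forces each [m i] to vanish and hence
    [M = 0]. *)
Lemma doubled_partition_not_uniq m c : (0 < M)%N ->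
  (\sum_(i < M) m i * i.+1)%N = M -> ~~ uniq (doubled_partition m c).
Proof.
move=> M0 mM; apply/negP => /count_uniq_mem u.
suff : (\sum_(i < M) m i * i.+1)%N = 0%N by lia.
apply: big1 => i _; have := u (2 * i.+1)%N.
by rewrite count_doubled_partition; case: (_ \in _); case: (m i : nat) => *; lia.
Qed.

Lemma card_le_admissible_classes (R : realType) c : (0 < M)%N ->
  all (leq 2) c ->
  `I_(npartitions M) #<= admissible_classes R (4 * M + sumn c)%N.
Proof.
move=> M0 hc; set N := (4 * M + sumn c)%N.
set P := [pred m : {ffun 'I_M -> 'I_M.+1} | (\sum_(i < M) m i * i.+1)%N == M].
have hP m : m \in P -> (\sum_(i < M) m i * i.+1)%N = M by move/eqP.
(* The default value is never reached for [k < npartitions M]. *)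
pose m_ k := nth [ffun=> ord0] (enum P) k.
have m_P k : (k < npartitions M)%N -> m_ k \in P.
  by move=> hk; rewrite -mem_enum mem_nth // -cardE.
have part k : (k < npartitions M)%N -> is_partition N (doubled_partition (m_ k) c).
  move=> hk; split.
    move=> j; apply: (@leq_trans 2) => //.
    exact: (allP (all_doubled_partition (m_ k) _ hc)) _ (mem_nth _ _).
  by rewrite sum_summand sumn_doubled_partition hP ?m_P.
pose f k := partition_class N (doubled_partition (m_ k) c).
have fA : set_fun `I_(npartitions M) (admissible_classes R N) f.
  move=> k /= hk; split; first by exists (doubled_partition (m_ k) c); [exact: part|].
  (* Admissibility concerns every representative [rho] of the class, so both properties are carried
     along [perm_eq]. *)
  move=> rho [_ /equiv_partitions_perm_eq e].
  have ge2 (j : 'I_(size rho)) : (2 <= summand j)%N.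
    have := all_doubled_partition (m_ k) _ hc; rewrite (perm_all _ e) => /allP.
    by apply; apply: mem_nth.
  split=> //; apply: weyl_nontrivial_of_not_uniq => [j|].
    exact: leq_trans (ge2 j).
  by rewrite -(perm_uniq e) doubled_partition_not_uniq // hP ?m_P.
have fI : set_inj `I_(npartitions M) f.
  move=> k l /set_mem /= hk /set_mem /= hl fkl.
  (* Equal classes share this representative, so the two doubled partitions are permutations of each
     other. *)
  have : f l (doubled_partition (m_ l) c).
    by split; [exact: part|exact: equiv_partitions_refl].
  rewrite -fkl => -[_ /equiv_partitions_perm_eq /doubled_partition_inj /eqP].
  by rewrite /m_ nth_uniq -?cardE ?enum_uniq // => /eqP.
rewrite -(card_le_eql (inj_card_eq fI)).
by apply: subset_card_le => _ [k hk <-]; apply: fA.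
Qed.

End Doubling.

Theorem proposition3p19 (R : realType) (N M : nat) (hN : (4 <= N)%N)
    (hM : (1 <= M)%N) :
  (N = (4 * M)%N ->
     `I_(npartitions (N %/ 4)) #<= admissible_classes R N) /\
  (N = (4 * M + 2)%N ->
     `I_(npartitions ((N - 2) %/ 4)) #<= admissible_classes R N) /\
  (N = (4 * M + 3)%N ->
     `I_(npartitions ((N - 3) %/ 4)) #<= admissible_classes R N) /\
  (N = (4 * M + 5)%N ->
     `I_(npartitions ((N - 5) %/ 4)) #<= admissible_classes R N).
Proof.
split=> [->|].
  by rewrite mulKn // -[X in admissible_classes R X]addn0;
    exact: (@card_le_admissible_classes M R [::]).
do 2?split=> [->|]; last move=> ->; rewrite addnK mulKn //.
- exact: (@card_le_admissible_classes M R [:: 2]).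
- exact: (@card_le_admissible_classes M R [:: 3]).
- exact: (@card_le_admissible_classes M R [:: 5]).
Qed.
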